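(* Let $n\geq 1$ and let $\alpha>0$ be such that $d_\alpha$ is a distance on $\mathbb H^n$. Then the Besicovitch Covering Property (BCP) holds for $d_\alpha$ on $\mathbb H^n$.
   Context: The Heisenberg group $\mathbb H^n$ is $\mathbb R^{2n+1}=\{(x,y,z): x,y\in\mathbb R^n, z\in\mathbb R\}$ with the Euclidean topology and group law $(x,y,z)\cdot(x',y',z')=(x+x',y+y',z+z'+\tfrac12\langle x,y'\rangle-\tfrac12\langle y,x'\rangle)$; the inverse of $(x,y,z)$ is $(-x,-y,-z)$. Dilations are $\delta_\lambda(x,y,z)=(\lambda x,\lambda y,\lambda^2 z)$, $\lambda>0$. For $\alpha>0$ let $B_\alpha=\{(x,y,z):\|x\|^2+\|y\|^2+z^2\leq\alpha^2\}$ (closed Euclidean ball) and define $d_\alpha(p,q)=\inf\{r>0:\delta_{1/r}(p^{-1}\cdot q)\in B_\alpha\}$. Balls are closed: $B_d(p,r)=\{q: d(q,p)\le r\}$, each ball coming with a fixed center and radius. BCP holds for a distance $d$ on $M$ if there is an integer $N\geq1$ such that for every bounded $A\subset M$ and every family $\mathcal B$ of balls such that each point of $A$ is the center of some ball of $\mathcal B$, there is a subfamily $\mathcal F\subset\mathcal B$ with $\chi_A\leq\sum_{B\in\mathcal F}\chi_B\leq N$. *)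

(* Defs.v *)
From Stdlib Require Import Reals Lra Classical ClassicalEpsilon FunctionalExtensionality List.
Open Scope R_scope.

(* A point (x,y,z) of R^{2n+1}; x,y are represented as functions nat -> R
   whose coordinates of index >= n are required to vanish (see [inH]). *)
Record pt := mkPt { px : nat -> R; py : nat -> R; pz : R }.

Definition inH (n : nat) (p : pt) : Prop :=
  forall i, (n <= i)%nat -> px p i = 0 /\ py p i = 0.

Fixpoint sumn (n : nat) (f : nat -> R) : R :=
  match n with O => 0 | S m => sumn m f + f m end.

Definition dot (n : nat) (u v : nat -> R) : R := sumn n (fun i => u i * v i).

Definition hmul (n : nat) (p q : pt) : pt :=
  mkPt (fun i => px p i + px q i) (fun i => py p i + py q i)
       (pz p + pz q + / 2 * dot n (px p) (py q) - / 2 * dot n (py p) (px q)).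

Definition hinv (p : pt) : pt :=
  mkPt (fun i => - px p i) (fun i => - py p i) (- pz p).

Definition dil (lam : R) (p : pt) : pt :=
  mkPt (fun i => lam * px p i) (fun i => lam * py p i) (lam ^ 2 * pz p).

Definition inBalpha (n : nat) (alpha : R) (p : pt) : Prop :=
  dot n (px p) (px p) + dot n (py p) (py p) + pz p ^ 2 <= alpha ^ 2.

Definition is_glb (E : R -> Prop) (m : R) : Prop :=
  (forall r, E r -> m <= r) /\ (forall b, (forall r, E r -> b <= r) -> b <= m).

Definition dalpha_set (n : nat) (alpha : R) (p q : pt) (r : R) : Prop :=
  0 < r /\ inBalpha n alpha (dil (/ r) (hmul n (hinv p) q)).

Definition dalpha (n : nat) (alpha : R) (p q : pt) : R :=
  epsilon (inhabits 0) (fun m => is_glb (dalpha_set n alpha p q) m).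

Definition is_distance (n : nat) (d : pt -> pt -> R) : Prop :=
  (forall p q, inH n p -> inH n q -> 0 <= d p q) /\
  (forall p q, inH n p -> inH n q -> (d p q = 0 <-> p = q)) /\
  (forall p q, inH n p -> inH n q -> d p q = d q p) /\
  (forall p q w, inH n p -> inH n q -> inH n w -> d p w <= d p q + d q w).

Definition ball := (pt * R)%type.

Definition in_ball (n : nat) (d : pt -> pt -> R) (b : ball) (q : pt) : Prop :=
  inH n q /\ d q (fst b) <= snd b.

Definition bounded (n : nat) (d : pt -> pt -> R) (A : pt -> Prop) : Prop :=
  exists p0 R0, inH n p0 /\ forall a, A a -> d a p0 <= R0.

(* sum_{B in F} chi_B (q) <= N : at most N distinct balls of F contain q *)
Definition overlap_le (n : nat) (d : pt -> pt -> R) (F : ball -> Prop) (N : nat) : Prop :=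
  forall q, inH n q -> forall l : list ball, NoDup l ->
    (forall b, In b l -> F b /\ in_ball n d b q) -> (length l <= N)%nat.

Definition BCP (n : nat) (d : pt -> pt -> R) : Prop :=
  exists N : nat, (1 <= N)%nat /\
  forall (A : pt -> Prop) (Bf : ball -> Prop),
    (forall a, A a -> inH n a) -> bounded n d A ->
    (forall b, Bf b -> inH n (fst b) /\ 0 < snd b) ->
    (forall a, A a -> exists r, Bf (a, r)) ->
    exists F : ball -> Prop,
      (forall b, F b -> Bf b) /\
      (forall a, A a -> exists b, F b /\ in_ball n d b a) /\
      overlap_le n d F N.

(* Main.v *)
(* The distance is d(p, q) = N(p^-1 q) for an explicit homogeneous norm N with unit ball B_alpha.
   The heart is that a Besicovitch family (balls with a common point q, no ball containing the
   center of another) has bounded cardinality. Translate q to 0 and shrink each radius to the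
   distance from q: the centers satisfy d(p, p') > max(N p, N p'). Dilate them to the unit
   sphere and sort the resulting points (V, Z) into finitely many cells according to the direction
   of V in R^{2n}, the sign of Z, and whether |V| < alpha / 2. If P and P' lie in the same cell
   and eps <= 1/12, then d(P, delta_eps P') <= 1. So within a cell the norms are comparable,
   and a packing argument bounds the number of centers.
   To deduce BCP, choose balls greedily by dyadic generations of the radius. Balls of one generation
   containing q are boundedly many by packing; balls of distinct generations containing q
   form a Besicovitch family. *)
Require Import Defs.
From Stdlib Require Import Reals Lra Lia Classical ClassicalEpsilon FunctionalExtensionality Wf_nat List.
Open Scope R_scope.

(** * Bilinearity and coordinate bounds for [dot] *)

Lemma dot_comm n f g : dot n f g = dot n g f.
Proof. unfold dot; induction n; simpl; [|rewrite IHn]; ring. Qed.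

Lemma dot_add_l n f g h : dot n (fun i => f i + g i) h = dot n f h + dot n g h.
Proof. unfold dot; induction n; simpl; [|rewrite IHn]; ring. Qed.

Lemma dot_scal_l n a f h : dot n (fun i => a * f i) h = a * dot n f h.
Proof. unfold dot; induction n; simpl; [|rewrite IHn]; ring. Qed.

Lemma dot_opp_l n f h : dot n (fun i => - f i) h = - dot n f h.
Proof. unfold dot; induction n; simpl; [|rewrite IHn]; ring. Qed.

Lemma dot_add_r n f g h : dot n h (fun i => f i + g i) = dot n h f + dot n h g.
Proof. now rewrite dot_comm, dot_add_l, !(dot_comm n h). Qed.

Lemma dot_scal_r n a f h : dot n h (fun i => a * f i) = a * dot n h f.
Proof. now rewrite dot_comm, dot_scal_l, (dot_comm n h). Qed.

Lemma dot_opp_r n f h : dot n h (fun i => - f i) = - dot n h f.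
Proof. now rewrite dot_comm, dot_opp_l, (dot_comm n h). Qed.

Lemma dot_self_ge0 n f : 0 <= dot n f f.
Proof.
  unfold dot; induction n; simpl; [lra|].
  pose proof (Rle_0_sqr (f n)); unfold Rsqr in *; lra.
Qed.

Lemma dot_self_coord n f i : (i < n)%nat -> f i ^ 2 <= dot n f f.
Proof.
  induction n; intros Hi; [lia|].
  change (dot (S n) f f) with (dot n f f + f n * f n).
  destruct (Nat.eq_dec i n) as [->|Hin].
  - pose proof (dot_self_ge0 n f); lra.
  - specialize (IHn ltac:(lia)). pose proof (Rle_0_sqr (f n)); unfold Rsqr in *; lra.
Qed.

Lemma dot_bound n f g M e : 0 <= M ->
  (forall i, (i < n)%nat -> Rabs (f i) <= M) ->
  (forall i, (i < n)%nat -> Rabs (g i) <= e) ->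
  Rabs (dot n f g) <= INR n * (M * e).
Proof.
  intros HM; induction n; intros Hf Hg.
  - unfold dot; simpl; rewrite Rabs_R0; lra.
  - change (dot (S n) f g) with (dot n f g + f n * g n). rewrite S_INR.
    pose proof (Rabs_triang (dot n f g) (f n * g n)).
    assert (Rabs (f n * g n) <= M * e).
    { rewrite Rabs_mult; apply Rmult_le_compat; auto using Rabs_pos. }
    assert (Rabs (dot n f g) <= INR n * (M * e)) by (apply IHn; auto with arith).
    lra.
Qed.

Lemma dot_zero n f g : (forall i, (i < n)%nat -> f i = 0) -> dot n f g = 0.
Proof.
  unfold dot; induction n; simpl; intros H; [reflexivity|].
  rewrite IHn, H; auto with arith; ring.
Qed.

(** * Horizontal inner product, symplectic form, and the group structure *)

Definition ip n p q := dot n (px p) (px q) + dot n (py p) (py q).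
Definition om n p q := dot n (px p) (py q) - dot n (py p) (px q).

Lemma ip_self_ge0 n p : 0 <= ip n p p.
Proof. unfold ip; pose proof (dot_self_ge0 n (px p)); pose proof (dot_self_ge0 n (py p)); lra. Qed.

(** Covers points on the vertical axis, which have no horizontal direction to sort by. *)
Lemma ip_self_eq0 n p q : ip n p p = 0 -> ip n p q = 0 /\ om n p q = 0.
Proof.
  unfold ip, om; intros H.
  pose proof (dot_self_ge0 n (px p)); pose proof (dot_self_ge0 n (py p)).
  assert (X : forall i, (i < n)%nat -> px p i = 0 /\ py p i = 0).
  { intros i Hi; pose proof (dot_self_coord n (px p) i Hi); pose proof (dot_self_coord n (py p) i Hi).
    split; apply Rsqr_0_uniq; unfold Rsqr; nra. }
  rewrite !dot_zero by (intros; now apply X). lra.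
Qed.

Lemma ip_comm n p q : ip n p q = ip n q p.
Proof. unfold ip; now rewrite (dot_comm n (px p)), (dot_comm n (py p)). Qed.

Lemma om_anticomm n p q : om n p q = - om n q p.
Proof. unfold om; rewrite (dot_comm n (px p)), (dot_comm n (py p)); ring. Qed.

Lemma ip_dil n a b p q : ip n (dil a p) (dil b q) = a * b * ip n p q.
Proof. unfold ip; simpl; rewrite !dot_scal_l, !dot_scal_r; ring. Qed.

Lemma om_dil n a b p q : om n (dil a p) (dil b q) = a * b * om n p q.
Proof. unfold om; simpl; rewrite !dot_scal_l, !dot_scal_r; ring. Qed.

Lemma ip_diff n p q :
  ip n (hmul n (hinv p) q) (hmul n (hinv p) q) = ip n p p + ip n q q - 2 * ip n p q.
Proof.
  unfold ip; simpl.
  repeat rewrite ?dot_add_l, ?dot_add_r, ?dot_opp_l, ?dot_opp_r.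
  rewrite (dot_comm n (px q) (px p)), (dot_comm n (py q) (py p)). ring.
Qed.

Lemma pz_diff n p q : pz (hmul n (hinv p) q) = pz q - pz p - / 2 * om n p q.
Proof. unfold om; simpl; rewrite !dot_opp_l; lra. Qed.

Lemma pt_ext p q : (forall i, px p i = px q i) -> (forall i, py p i = py q i) ->
  pz p = pz q -> p = q.
Proof.
  destruct p, q; simpl; intros Hx Hy ->. f_equal; apply functional_extensionality; auto.
Qed.

Lemma left_cancel n w p q :
  hmul n (hinv (hmul n w p)) (hmul n w q) = hmul n (hinv p) q.
Proof.
  apply pt_ext; simpl; [intro; ring|intro; ring|].
  repeat rewrite ?dot_add_l, ?dot_add_r, ?dot_opp_l, ?dot_opp_r.
  rewrite (dot_comm n (px w) (py w)), (dot_comm n (py p) (px w)), (dot_comm n (px p) (py w)).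
  lra.
Qed.

Lemma dil_dil a b p : dil a (dil b p) = dil (a * b) p.
Proof. apply pt_ext; simpl; intros; ring. Qed.

Lemma dil_1 p : dil 1 p = p.
Proof. apply pt_ext; simpl; intros; ring. Qed.

Lemma dil_diff n a p q :
  hmul n (hinv (dil a p)) (dil a q) = dil a (hmul n (hinv p) q).
Proof.
  apply pt_ext; simpl; [intro; ring|intro; ring|].
  rewrite !dot_opp_l, !dot_scal_l, !dot_scal_r. ring.
Qed.

(* The square of the norm is the nonnegative root [t] of [alpha^2 t^2 = ip p p * t + z^2]. *)
Definition hnorm n alpha p :=
  sqrt ((ip n p p + sqrt (ip n p p ^ 2 + 4 * alpha ^ 2 * pz p ^ 2)) / (2 * alpha ^ 2)).

(** * The homogeneous norm and its identification with [dalpha] *)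

Section Norm.
Variables (n : nat) (alpha : R).
Hypothesis alpha_gt0 : 0 < alpha.

Let hn := hnorm n alpha.
Let d := dalpha n alpha.

Lemma hnorm_ge0 p : 0 <= hn p.
Proof. apply sqrt_pos. Qed.

Lemma hnorm_root_ge0 p :
  0 <= (ip n p p + sqrt (ip n p p ^ 2 + 4 * alpha ^ 2 * pz p ^ 2)) / (2 * alpha ^ 2).
Proof.
  pose proof (ip_self_ge0 n p); pose proof (sqrt_pos (ip n p p ^ 2 + 4 * alpha ^ 2 * pz p ^ 2)).
  apply Rmult_le_pos; [lra|]. left; apply Rinv_0_lt_compat; nra.
Qed.

Lemma hnorm_eq p : ip n p p * hn p ^ 2 + pz p ^ 2 = alpha ^ 2 * hn p ^ 4.
Proof.
  replace (hn p ^ 4) with ((hn p ^ 2) ^ 2) by ring.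
  unfold hn, hnorm; rewrite pow2_sqrt by apply hnorm_root_ge0.
  set (a := ip n p p); set (D := a ^ 2 + 4 * alpha ^ 2 * pz p ^ 2).
  assert (HD : 0 <= D) by (unfold D; nra).
  pose proof (pow2_sqrt D HD) as E; set (s := sqrt D) in *; unfold D in E.
  replace (pz p ^ 2) with ((s ^ 2 - a ^ 2) / (4 * alpha ^ 2)) by (rewrite E; field; lra).
  field; lra.
Qed.

Lemma hnorm_le p r : 0 < r ->
  (hn p <= r <-> ip n p p * r ^ 2 + pz p ^ 2 <= alpha ^ 2 * r ^ 4).
Proof.
  intros Hr. pose proof (hnorm_eq p) as E; pose proof (hnorm_ge0 p) as N0.
  pose proof (ip_self_ge0 n p) as I0; set (a := ip n p p) in *; set (N := hn p) in *.
  pose proof (pow2_ge_0 (pz p)) as Z0; set (z := pz p ^ 2) in *.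
  assert (A2 : 0 < alpha ^ 2) by nra.
  (* With [t = r^2], [T = N^2]: [(alpha^2 t^2 - a t - z) = (t - T) (alpha^2 (t + T) - a)],
     and [alpha^2 T >= a] unless [T = 0]. *)
  assert (Hf : alpha ^ 2 * r ^ 4 - (a * r ^ 2 + z)
               = (r ^ 2 - N ^ 2) * (alpha ^ 2 * (r ^ 2 + N ^ 2) - a)).
  { replace z with (alpha ^ 2 * N ^ 4 - a * N ^ 2) by lra. ring. }
  assert (HT : a <= alpha ^ 2 * N ^ 2).
  { unfold N, hn, hnorm; rewrite pow2_sqrt by apply hnorm_root_ge0.
    fold a. rewrite Rmult_comm; unfold Rdiv; rewrite Rmult_assoc.
    replace (/ (2 * alpha ^ 2) * alpha ^ 2) with (/ 2) by (field; lra).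
    enough (a <= sqrt (a ^ 2 + 4 * alpha ^ 2 * pz p ^ 2)) by lra.
    rewrite <- (sqrt_pow2 a) at 1 by assumption. apply sqrt_le_1_alt; nra. }
  assert (Hp : 0 < alpha ^ 2 * (r ^ 2 + N ^ 2) - a).
  { assert (H2 : 0 < r ^ 2) by (apply pow_lt; lra).
    pose proof (Rmult_lt_0_compat _ _ A2 H2). lra. }
  split; intros H.
  - assert (0 <= r ^ 2 - N ^ 2) by nra. nra.
  - destruct (Rle_lt_dec N r); [assumption|exfalso].
    assert (r ^ 2 - N ^ 2 < 0) by nra. nra.
Qed.

Lemma dalphaE p q : d p q = hn (hmul n (hinv p) q).
Proof.
  assert (S : forall r, dalpha_set n alpha p q r <-> 0 < r /\ hn (hmul n (hinv p) q) <= r).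
  { intros r; unfold dalpha_set; set (w := hmul n (hinv p) q).
    enough (0 < r -> (inBalpha n alpha (dil (/ r) w) <-> hn w <= r)) by intuition.
    intros Hr; rewrite hnorm_le by assumption. unfold inBalpha.
    change (ip n (dil (/ r) w) (dil (/ r) w) + (((/ r) ^ 2) * pz w) ^ 2 <= alpha ^ 2 <->
            ip n w w * r ^ 2 + pz w ^ 2 <= alpha ^ 2 * r ^ 4).
    rewrite ip_dil.
    replace (/ r * / r * ip n w w + ((/ r) ^ 2 * pz w) ^ 2)
      with ((ip n w w * r ^ 2 + pz w ^ 2) / r ^ 4) by (field; lra).
    assert (0 < r ^ 4) by (apply pow_lt; lra).
    split; intros H0.
    - apply (Rmult_le_compat_r (r ^ 4)) in H0; [|lra].
      unfold Rdiv in H0; rewrite Rmult_assoc, Rinv_l in H0; lra.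
    - apply (Rmult_le_reg_r (r ^ 4)); [assumption|].
      unfold Rdiv; rewrite Rmult_assoc, Rinv_l; lra. }
  (* By [S] the set is the positive part of the ray from [N]. Its infimum is [N] even when [N = 0]
     is excluded, since midpoints above [N] belong to it. *)
  set (N := hn (hmul n (hinv p) q)) in *.
  assert (N0 : 0 <= N) by apply hnorm_ge0.
  assert (G : is_glb (dalpha_set n alpha p q) N).
  { split.
    - intros r Hr; apply S in Hr; lra.
    - intros b Hb. apply Rnot_lt_le; intros Hlt.
      assert (b <= (b + N) / 2) by (apply Hb, S; lra). lra. }
  assert (G' := epsilon_spec (inhabits 0) _ (ex_intro _ N G)).
  fold (dalpha n alpha p q) in G'. fold d in G'.
  apply Rle_antisym; [apply (proj2 G), (proj1 G')|apply (proj2 G'), (proj1 G)].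
Qed.

Lemma dalpha_left w p q : d (hmul n w p) (hmul n w q) = d p q.
Proof. now rewrite !dalphaE, left_cancel. Qed.

Lemma hnorm_dil a p : 0 < a -> hn (dil a p) = a * hn p.
Proof.
  intros Ha; unfold hn, hnorm; rewrite ip_dil; simpl pz.
  replace ((a * a * ip n p p) ^ 2 + 4 * alpha ^ 2 * (a * (a * 1) * pz p) ^ 2)
    with ((a ^ 2) ^ 2 * (ip n p p ^ 2 + 4 * alpha ^ 2 * pz p ^ 2)) by ring.
  rewrite sqrt_mult_alt by (apply pow2_ge_0).
  rewrite sqrt_pow2 by (apply pow2_ge_0).
  match goal with |- sqrt ?u = a * sqrt ?v => replace u with (a ^ 2 * v) by (field; lra) end.
  rewrite sqrt_mult_alt by (apply pow2_ge_0).
  rewrite sqrt_pow2; lra.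
Qed.

Lemma dalpha_dil a p q : 0 < a -> d (dil a p) (dil a q) = a * d p q.
Proof. intros; rewrite !dalphaE, dil_diff; now apply hnorm_dil. Qed.

Lemma dalpha_le p q r : 0 < r ->
  (ip n p p + ip n q q - 2 * ip n p q) * r ^ 2
    + (pz q - pz p - / 2 * om n p q) ^ 2 <= alpha ^ 2 * r ^ 4 -> d p q <= r.
Proof.
  intros Hr H; rewrite dalphaE; apply hnorm_le; [assumption|].
  now rewrite ip_diff, pz_diff.
Qed.

End Norm.

(** * Finite colourings and counting *)

(** Cells are the fibres of a colouring, so [Q] may be a mere closeness relation, with no symmetry
    or transitivity required. *)
Definition fin_cells {T : Type} (P : T -> Prop) (Q : T -> T -> Prop) : Prop :=
  exists (C : Type) (cs : list C) (col : T -> C),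
    (forall t, P t -> In (col t) cs) /\
    (forall t u, P t -> P u -> col t = col u -> Q t u).

Lemma fin_cells_and {T} (P : T -> Prop) Q1 Q2 :
  fin_cells P Q1 -> fin_cells P Q2 -> fin_cells P (fun t u => Q1 t u /\ Q2 t u).
Proof.
  intros (C1 & cs1 & f1 & I1 & H1) (C2 & cs2 & f2 & I2 & H2).
  exists (C1 * C2)%type, (list_prod cs1 cs2), (fun t => (f1 t, f2 t)); split.
  - intros t Ht; apply in_prod; auto.
  - intros t u Ht Hu E; injection E; auto.
Qed.

Lemma fin_cells_iff {T} (P S : T -> Prop) : fin_cells P (fun t u => S t <-> S u).
Proof.
  exists bool, (true :: false :: nil),
    (fun t => if excluded_middle_informative (S t) then true else false); split.
  - intros t _; destruct excluded_middle_informative; simpl; auto.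
  - intros t u _ _; do 2 destruct excluded_middle_informative; try discriminate; tauto.
Qed.

Lemma fin_cells_comap {T U} (g : U -> T) (P : T -> Prop) Q (P' : U -> Prop) :
  (forall u, P' u -> P (g u)) ->
  fin_cells P Q -> fin_cells P' (fun u v => Q (g u) (g v)).
Proof.
  intros HP (C & cs & f & I & H); exists C, cs, (fun u => f (g u)); split; auto.
Qed.

Lemma fin_cells_weaken {T} (P : T -> Prop) (Q Q' : T -> T -> Prop) :
  (forall u v, P u -> P v -> Q u v -> Q' u v) -> fin_cells P Q -> fin_cells P Q'.
Proof.
  intros HQ (C & cs & f & I & H); exists C, cs, f; split; auto.
Qed.

Lemma fin_cells_interval M e : 0 < e ->
  fin_cells (fun t => Rabs t <= M) (fun t u => Rabs (u - t) <= e).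
Proof.
  intros He. set (B := up (M / e)).
  (* The colours listed are the integers from [-B] to [B + 1]; equal colours put [t / e] and [u / e]
     in one interval of length 1. *)
  exists Z, (map (fun k => Z.of_nat k - B)%Z (seq 0 (Z.to_nat (2 * B + 2)))), (fun t => up (t / e)).
  assert (HM : M / e < IZR B) by apply archimed.
  split.
  - intros t Ht. assert (Ht2 : - (M / e) <= t / e <= M / e).
    { pose proof (Rle_abs t); pose proof (Rle_abs (- t)); rewrite Rabs_Ropp in *.
      unfold Rdiv; split.
      - rewrite <- Ropp_mult_distr_l_reverse; apply Rmult_le_compat_r; [left; now apply Rinv_0_lt_compat|lra].
      - apply Rmult_le_compat_r; [left; now apply Rinv_0_lt_compat|lra]. }
    destruct (archimed (t / e)) as [U1 U2].
    assert (- B < up (t / e))%Z by (apply lt_IZR; rewrite opp_IZR; lra).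
    assert (up (t / e) < B + 2)%Z by (apply lt_IZR; rewrite plus_IZR; lra).
    apply in_map_iff; exists (Z.to_nat (up (t / e) + B)); split; [lia|].
    apply in_seq; lia.
  - intros t u _ _ E. destruct (archimed (t / e)), (archimed (u / e)). rewrite E in *.
    replace (u - t) with ((u / e - t / e) * e) by (field; lra).
    rewrite Rabs_mult, (Rabs_right e) by lra.
    assert (Rabs (u / e - t / e) <= 1) by (apply Rabs_le; lra). nra.
Qed.

Lemma fin_cells_box m M e : 0 < e ->
  fin_cells (fun v : nat -> R => forall i, (i < m)%nat -> Rabs (v i) <= M)
    (fun v w => forall i, (i < m)%nat -> Rabs (w i - v i) <= e).
Proof.
  intros He; induction m.
  - exists unit, (tt :: nil), (fun _ => tt); split; [simpl; auto|intros; lia].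
  - set (P := fun v : nat -> R => forall i, (i < S m)%nat -> Rabs (v i) <= M).
    assert (H1 := fin_cells_comap (fun v => v) _ _ P
      (fun v (Hv : P v) i Hi => Hv i (Nat.lt_lt_succ_r _ _ Hi)) IHm).
    assert (H2 := fin_cells_comap (fun v : nat -> R => v m) _ _ P
      (fun v (Hv : P v) => Hv m (Nat.lt_succ_diag_r m)) (fin_cells_interval M e He)).
    refine (fin_cells_weaken _ _ _ _ (fin_cells_and _ _ _ H1 H2)).
    intros v w _ _ [A B] i Hi. destruct (Nat.eq_dec i m) as [->|]; [exact B|apply A; lia].
Qed.

Lemma pigeonhole {X C} (f : X -> C) (cs : list C) (K : nat) (l : list X) :
  NoDup l -> (forall x, In x l -> In (f x) cs) ->
  (forall c l', NoDup l' -> incl l' l -> (forall x, In x l' -> f x = c) -> (length l' <= K)%nat) ->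
  (length l <= length cs * K)%nat.
Proof.
  revert l; induction cs as [|c cs IH]; intros l Hl Hc HK.
  - destruct l as [|x l]; [auto|destruct (Hc x); simpl; auto].
  - set (b := fun x => if excluded_middle_informative (f x = c) then true else false).
    assert (Hb : forall x, b x = true <-> f x = c)
      by (intros x; unfold b; destruct excluded_middle_informative; intuition discriminate).
    rewrite <- (filter_length b l); simpl; apply Nat.add_le_mono.
    + apply (HK c); [now apply NoDup_filter|apply incl_filter|].
      intros x Hx; apply filter_In in Hx; now apply Hb.
    + apply IH; [now apply NoDup_filter| |].
      * intros x Hx; apply filter_In in Hx as [Hx Hn].
        destruct (Hc x Hx) as [E|]; [|assumption].
        symmetry in E; apply Hb in E; rewrite E in Hn; discriminate.
      * intros c' l' N I E; apply (HK c'); auto.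
        eapply incl_tran; [exact I|apply incl_filter].
Qed.

Lemma fin_cells_length {T} (P : T -> Prop) Q K : fin_cells P Q ->
  exists N, forall (X : Type) (f : X -> T) (l : list X), NoDup l ->
    (forall x, In x l -> P (f x)) ->
    (forall l', NoDup l' -> incl l' l ->
       (forall x y, In x l' -> In y l' -> Q (f x) (f y)) -> (length l' <= K)%nat) ->
    (length l <= N)%nat.
Proof.
  intros (C & cs & col & I & H). exists (length cs * K)%nat; intros X f l Hl HP HK.
  apply (pigeonhole (fun x => col (f x))); [assumption|auto|].
  intros c l' N' I' E; apply HK; auto.
  intros x y Hx Hy; apply H; auto. now rewrite (E x Hx), (E y Hy).
Qed.

Lemma separated_length {T} (P : T -> Prop) Q : fin_cells P Q ->
  exists N, forall (X : Type) (f : X -> T) (l : list X), NoDup l ->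
    (forall x, In x l -> P (f x)) ->
    (forall x y, In x l -> In y l -> x <> y -> ~ Q (f x) (f y)) ->
    (length l <= N)%nat.
Proof.
  intros F; destruct (fin_cells_length P Q 1 F) as [N HN]; exists N.
  intros X f l Hl HP Hs; apply (HN X f); auto.
  intros [|x [|y l']] N' I' Q'; simpl; try lia; exfalso.
  apply (Hs x y); [apply I'; simpl; auto|apply I'; simpl; auto| |apply Q'; simpl; auto].
  intros ->; inversion N'; simpl in *; tauto.
Qed.

(** Keeps one representative per value; it will select one ball per generation. *)
Lemma distinct_values {X C} (f : X -> C) (l : list X) : NoDup l ->
  exists l', NoDup l' /\ incl l' l /\
    (forall x y, In x l' -> In y l' -> x <> y -> f x <> f y) /\
    (forall x, In x l -> In (f x) (map f l')).
Proof.
  induction l as [|a l IH]; intros Hl.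
  - exists nil; repeat split; auto using NoDup_nil, incl_refl; simpl; tauto.
  - inversion Hl as [|? ? Ha Hl']; subst.
    destruct (IH Hl') as (l' & N & I & D & V).
    destruct (classic (In (f a) (map f l'))) as [Hin|Hout].
    + exists l'; repeat split; auto using incl_tl. intros x [<-|]; auto.
    + exists (a :: l'); repeat split.
      * constructor; auto.
      * apply incl_cons; [simpl; auto|auto using incl_tl].
      * intros x y [<-|Hx] [<-|Hy] Hxy E; [tauto| | |now apply (D x y)].
        -- apply Hout; rewrite E; now apply in_map.
        -- apply Hout; rewrite <- E; now apply in_map.
      * intros x [<-|Hx]; simpl; auto.
Qed.

Lemma longest_list {X} (P : list X -> Prop) (M : nat) (l0 : list X) :
  P l0 -> (forall l, P l -> (length l <= M)%nat) ->
  exists l, P l /\ forall l', P l' -> (length l' <= length l)%nat.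
Proof.
  intros H0 HM. remember (M - length l0)%nat as k eqn:Ek.
  revert l0 H0 Ek; induction k as [k IH] using lt_wf_ind; intros l0 H0 Ek.
  destruct (classic (exists l, P l /\ (length l0 < length l)%nat)) as [(l & Hl & L)|Hn].
  - apply (IH (M - length l)%nat) with (l0 := l); auto. specialize (HM l Hl); lia.
  - exists l0; split; [assumption|]. intros l' Hl'.
    apply Nat.nlt_ge; intros L; apply Hn; eauto.
Qed.

Lemma max_element {X} (f : X -> R) (l : list X) : l <> nil ->
  exists x, In x l /\ forall y, In y l -> f y <= f x.
Proof.
  induction l as [|a [|b l] IH]; intros Hl; [tauto| |].
  - exists a; split; [simpl; auto|]. intros y [<-|[]]; lra.
  - destruct IH as (x & Hx & Hm); [discriminate|].
    destruct (Rle_lt_dec (f a) (f x)).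
    + exists x; split; [now right|]. intros y [<-|]; auto.
    + exists a; split; [now left|]. intros y [<-|Hy]; [lra|]. specialize (Hm y Hy); lra.
Qed.

(* Expanding and dividing by [eps], the claim is
   [eps (b^2 + (eps z' - O/2)^2 - 2 z z') <= 2 s - z O], whose right-hand side is at least [a b].
   If [a] and [b] are not small, [a b] wins once [eps] is small; if both are small, the bracket
   is negative because [z z'] is close to [alpha^2]. *)
Lemma sphere_estimate alpha a b s O z z' eta eps :
  0 < alpha -> 0 <= a -> 0 <= b -> a ^ 2 + z ^ 2 = alpha ^ 2 -> b ^ 2 + z' ^ 2 = alpha ^ 2 ->
  0 <= eta <= / 4 -> alpha * eta <= / 2 ->
  a * b * (1 - eta) <= s -> Rabs O <= a * b * eta ->
  (0 <= z <-> 0 <= z') -> (a < alpha / 2 <-> b < alpha / 2) -> 0 < eps <= / 12 ->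
  a ^ 2 + eps ^ 2 * b ^ 2 - 2 * eps * s + (eps ^ 2 * z' - z - / 2 * eps * O) ^ 2 <= alpha ^ 2.
Proof.
  intros Ha A0 B0 Ea Eb He Hae Hs HO Hz Hab Heps.
  assert (Hab0 : 0 <= a * b) by nra.
  assert (Za : Rabs z <= alpha) by (apply Rabs_le; nra).
  assert (Zb : Rabs z' <= alpha) by (apply Rabs_le; nra).
  assert (ZZ : 0 <= z * z').
  { destruct (Rle_lt_dec 0 z) as [H|H].
    - apply Hz in H as H'; nra.
    - destruct (Rle_lt_dec 0 z') as [H'|H']; [apply Hz in H'; lra|nra]. }
  assert (HzO : Rabs (z * O) <= a * b * / 2).
  { rewrite Rabs_mult. apply Rle_trans with (alpha * (a * b * eta)).
    - apply Rmult_le_compat; auto using Rabs_pos.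
    - nra. }
  assert (HzO' := Rle_abs (z * O)).
  (* As [eta <= 1/4], [2 s] is at least [(3/2) a b], and [z O] costs at most [a b / 2]. *)
  assert (L : a * b <= 2 * s - z * O) by nra.
  enough (eps * (b ^ 2 + (eps * z' - / 2 * O) ^ 2 - 2 * (z * z')) <= a * b) by nra.
  assert (T : forall m, Rabs O <= m -> (eps * z' - / 2 * O) ^ 2 <= (alpha / 12 + / 2 * m) ^ 2).
  { intros m Hm. apply pow_maj_Rabs. unfold Rminus.
    eapply Rle_trans; [apply Rabs_triang|]. rewrite Rabs_Ropp, !Rabs_mult.
    rewrite (Rabs_right eps), (Rabs_right (/ 2)) by lra.
    assert (eps * Rabs z' <= / 12 * alpha) by (apply Rmult_le_compat; auto using Rabs_pos; lra).
    lra. }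
  destruct (Rlt_le_dec a (alpha / 2)) as [Hs1|Hl1].
  (* In units of [alpha^2], the bracket is at most [1/4 + (1/12 + 1/16)^2 - 3/2 < 0]. *)
  - assert (Hs2 : b < alpha / 2) by tauto.
    assert (Om : Rabs O <= alpha / 8).
    { eapply Rle_trans; [exact HO|]. assert (a * b <= alpha * alpha / 4) by nra. nra. }
    apply T in Om.
    assert (3 / 4 * alpha ^ 2 <= z * z').
    { assert (3 / 4 * alpha ^ 2 <= z ^ 2) by nra. assert (3 / 4 * alpha ^ 2 <= z' ^ 2) by nra.
      apply Rsqr_incr_0_var; [|assumption]. unfold Rsqr.
      replace (z * z' * (z * z')) with (z ^ 2 * z' ^ 2) by ring.
      apply Rmult_le_compat; nra. }
    assert (b ^ 2 <= alpha ^ 2 / 4) by nra.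
    assert (b ^ 2 + (eps * z' - / 2 * O) ^ 2 - 2 * (z * z') <= 0) by nra.
    nra.
  (* Here the bracket is at most [2 alpha^2] and [a b >= alpha^2 / 4], so [eps <= 1/12] suffices. *)
  - assert (Hl2 : alpha / 2 <= b) by (destruct (Rlt_le_dec b (alpha / 2)); [tauto || lra|assumption]).
    assert (Om : Rabs O <= alpha).
    { eapply Rle_trans; [exact HO|].
      assert (a <= alpha) by nra. assert (b <= alpha) by nra.
      assert (a * b <= alpha * alpha) by (apply Rmult_le_compat; lra). nra. }
    apply T in Om.
    assert (b ^ 2 + (eps * z' - / 2 * O) ^ 2 - 2 * (z * z') <= 2 * alpha ^ 2) by nra.
    assert (alpha ^ 2 / 4 <= a * b) by nra.
    destruct (Rle_lt_dec (b ^ 2 + (eps * z' - / 2 * O) ^ 2 - 2 * (z * z')) 0); nra.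
Qed.

(** * Cells of the unit ball and of the unit sphere *)

Section Cells.
Variables (n : nat) (alpha : R).
Hypothesis alpha_gt0 : 0 < alpha.

Let hn := hnorm n alpha.
Let d := dalpha n alpha.

Lemma coord_bound p i a : 0 <= a -> (i < n)%nat -> ip n p p <= a ^ 2 ->
  Rabs (px p i) <= a /\ Rabs (py p i) <= a.
Proof.
  intros Ha Hi H; unfold ip in H.
  pose proof (dot_self_coord n (px p) i Hi); pose proof (dot_self_coord n (py p) i Hi).
  pose proof (dot_self_ge0 n (px p)); pose proof (dot_self_ge0 n (py p)).
  split; apply Rabs_le; nra.
Qed.

Definition close e p q := forall i, (i < n)%nat ->
  Rabs (px q i - px p i) <= e /\ Rabs (py q i - py p i) <= e.

Lemma fin_cells_close M e : 0 < e ->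
  fin_cells (fun p => forall i, (i < n)%nat -> Rabs (px p i) <= M /\ Rabs (py p i) <= M) (close e).
Proof.
  intros He.
  set (P := fun p => forall i, (i < n)%nat -> Rabs (px p i) <= M /\ Rabs (py p i) <= M).
  assert (H1 := fin_cells_comap px _ _ P (fun p (Hp : P p) i Hi => proj1 (Hp i Hi)) (fin_cells_box n M e He)).
  assert (H2 := fin_cells_comap py _ _ P (fun p (Hp : P p) i Hi => proj2 (Hp i Hi)) (fin_cells_box n M e He)).
  refine (fin_cells_weaken _ _ _ _ (fin_cells_and _ _ _ H1 H2)).
  intros p q _ _ [A B] i Hi; split; auto.
Qed.

(** With [D = q - p] horizontally, the three quantities are [<p, D>], [om p D] (because
    [om p p = 0]) and [|D|^2]. *)
Lemma close_estimates p q M e : 0 <= M -> close e p q ->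
  (forall i, (i < n)%nat -> Rabs (px p i) <= M /\ Rabs (py p i) <= M) ->
  Rabs (ip n p q - ip n p p) <= 2 * INR n * (M * e) /\
  Rabs (om n p q) <= 2 * INR n * (M * e) /\
  ip n p p + ip n q q - 2 * ip n p q <= 2 * INR n * (e * e).
Proof.
  intros HM Hc Hp. set (dx := fun i => px q i + - px p i). set (dy := fun i => py q i + - py p i).
  assert (Dx : forall i, (i < n)%nat -> Rabs (dx i) <= e) by (intros; now apply Hc).
  assert (Dy : forall i, (i < n)%nat -> Rabs (dy i) <= e) by (intros; now apply Hc).
  assert (B : forall f g m, 0 <= m -> (forall i, (i < n)%nat -> Rabs (f i) <= m) ->
     (forall i, (i < n)%nat -> Rabs (g i) <= e) -> - (INR n * (m * e)) <= dot n f g <= INR n * (m * e)).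
  { intros f g m Hm Hf Hg. pose proof (dot_bound n f g m e Hm Hf Hg) as H.
    pose proof (Rle_abs (dot n f g)); pose proof (Rle_abs (- dot n f g)); rewrite Rabs_Ropp in *; lra. }
  assert (Hpx : forall i, (i < n)%nat -> Rabs (px p i) <= M) by (intros; now apply Hp).
  assert (Hpy : forall i, (i < n)%nat -> Rabs (py p i) <= M) by (intros; now apply Hp).
  unfold ip, om. repeat split.
  - replace (_ - _) with (dot n (px p) dx + dot n (py p) dy)
      by (unfold dx, dy; rewrite !dot_add_r, !dot_opp_r; ring).
    pose proof (B (px p) dx M HM Hpx Dx); pose proof (B (py p) dy M HM Hpy Dy).
    apply Rabs_le; lra.
  - replace (_ - _) with (dot n (px p) dy - dot n (py p) dx)
      by (unfold dx, dy; rewrite !dot_add_r, !dot_opp_r, (dot_comm n (py p) (px p)); ring).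
    pose proof (B (px p) dy M HM Hpx Dy); pose proof (B (py p) dx M HM Hpy Dx).
    apply Rabs_le; lra.
  - replace (_ - _) with (dot n dx dx + dot n dy dy).
    2:{ unfold dx, dy; repeat rewrite ?dot_add_l, ?dot_add_r, ?dot_opp_l, ?dot_opp_r.
        rewrite (dot_comm n (px q) (px p)), (dot_comm n (py q) (py p)); ring. }
    (* For [n = 0], [close e] is vacuous and does not give [0 <= e]. *)
    destruct n as [|m] eqn:En; [unfold dot; simpl; lra|].
    assert (0 <= e) by (eapply Rle_trans; [apply Rabs_pos|apply (Dx 0%nat); lia]).
    pose proof (B dx dx e ltac:(assumption) Dx Dx); pose proof (B dy dy e ltac:(assumption) Dy Dy). lra.
Qed.

Lemma ball_cells s : 0 < s -> fin_cells (fun p => hn p <= 1) (fun p q => d p q <= s).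
Proof.
  intros Hs. pose proof (pos_INR n) as Hn.
  set (k := (1 + INR n) * (1 + alpha)).
  assert (Hk : 1 + INR n + alpha + INR n * alpha = k) by (unfold k; ring).
  (* Capping at 1 gives [t^2 <= t], used in the horizontal bound [Ei]. *)
  set (t := Rmin s 1). assert (Ht : 0 < t <= 1 /\ t <= s).
  { unfold t; pose proof (Rmin_l s 1); pose proof (Rmin_r s 1); repeat split; try lra.
    apply Rmin_glb_lt; lra. }
  assert (Hna : 0 <= INR n * alpha) by (apply Rmult_le_pos; lra).
  (* With this [e] the vertical difference is at most [t^2 alpha / 2] and the squared horizontal one
     at most [t^2 alpha^2 / 2]. They contribute [1/4] and [1/2] of the allowed [alpha^2 t^4]. *)
  set (e := t ^ 2 * alpha / (2 * k)).
  assert (Ek : 2 * (e * k) = t ^ 2 * alpha) by (unfold e; field; lra).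
  assert (He : 0 < e).
  { unfold e; apply Rdiv_lt_0_compat; [apply Rmult_lt_0_compat; [apply pow_lt|]|]; lra. }
  assert (HP : forall p, hn p <= 1 -> ip n p p <= alpha ^ 2 /\ Rabs (pz p) <= alpha).
  { intros p Hp; apply hnorm_le in Hp; try lra.
    pose proof (ip_self_ge0 n p). split; [nra|apply Rabs_le; nra]. }
  assert (HC : forall p, hn p <= 1 -> forall i, (i < n)%nat -> Rabs (px p i) <= alpha /\ Rabs (py p i) <= alpha).
  { intros p Hp i Hi; apply coord_bound; [lra|assumption|now apply HP]. }
  assert (H1 := fin_cells_comap (fun p => p) _ _ _ HC (fin_cells_close alpha e He)).
  assert (H2 := fin_cells_comap pz _ _ _ (fun p Hp => proj2 (HP p Hp)) (fin_cells_interval alpha e He)).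
  refine (fin_cells_weaken _ _ _ _ (fin_cells_and _ _ _ H1 H2)).
  intros p q Hp Hq [A B].
  destruct (close_estimates p q alpha e ltac:(lra) A (HC p Hp)) as (_ & EO & EI).
  apply Rle_trans with t; [|lra]. apply dalpha_le; [assumption|lra|].
  assert (Ez : (pz q - pz p - / 2 * om n p q) ^ 2 <= (t ^ 2 * alpha / 2) ^ 2).
  { apply pow_maj_Rabs. unfold Rminus at 1. eapply Rle_trans; [apply Rabs_triang|].
    rewrite Rabs_Ropp, Rabs_mult, (Rabs_right (/ 2)) by lra.
    assert (e * (1 + INR n * alpha) <= e * k) by (apply Rmult_le_compat_l; lra). nra. }
  assert (Ei : 2 * INR n * (e * e) <= t ^ 2 * alpha ^ 2 / 2).
  { assert (e * (1 + INR n) <= e * k) by (apply Rmult_le_compat_l; lra).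
    assert (0 <= e * INR n) by (apply Rmult_le_pos; lra).
    assert (t ^ 2 * alpha <= t * alpha) by nra.
    assert (2 * (e * (1 + INR n)) <= t * alpha) by lra.
    assert ((2 * (e * (1 + INR n))) ^ 2 <= (t * alpha) ^ 2) by (apply pow_incr; lra).
    nra. }
  assert (0 <= t ^ 2) by nra.
  assert ((ip n p p + ip n q q - 2 * ip n p q) * t ^ 2 <= t ^ 2 * alpha ^ 2 / 2 * t ^ 2)
    by (apply Rmult_le_compat_r; lra).
  nra.
Qed.

Lemma sphere_cells :
  fin_cells (fun p => hn p = 1) (fun p q => forall eps, 0 < eps <= / 12 -> d p (dil eps q) <= 1).
Proof.
  pose proof (pos_INR n) as Hn.
  (* The tolerance required by [sphere_estimate]; [e] below is the coordinatewise closeness of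
     directions that yields it. *)
  set (eta := Rmin (/ 4) (/ (2 * alpha))).
  assert (Heta : 0 < eta <= / 4 /\ alpha * eta <= / 2).
  { unfold eta; pose proof (Rmin_l (/ 4) (/ (2 * alpha))); pose proof (Rmin_r (/ 4) (/ (2 * alpha))).
    repeat split; try lra.
    - apply Rmin_glb_lt; [lra|apply Rinv_0_lt_compat; lra].
    - apply Rle_trans with (alpha * / (2 * alpha)); [apply Rmult_le_compat_l; lra|].
      right; field; lra. }
  set (e := eta / (2 * (1 + INR n))).
  assert (Ee : 2 * (e * (1 + INR n)) = eta) by (unfold e; field; lra).
  assert (He : 0 < e) by (unfold e; apply Rdiv_lt_0_compat; lra).
  set (A := fun p => sqrt (ip n p p)).
  assert (HA : forall p, 0 <= A p /\ A p ^ 2 = ip n p p).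
  { intros p; split; [apply sqrt_pos|apply pow2_sqrt, ip_self_ge0]. }
  (* The horizontal direction of [p]. If [A p = 0], the convention [/ 0 = 0] makes [u p] the origin,
     so the coordinate bound [HC] still holds. *)
  set (u := fun p => dil (/ A p) p).
  assert (Hu : forall p, A p <> 0 -> ip n (u p) (u p) = 1).
  { intros p Hp; unfold u; rewrite ip_dil, <- (proj2 (HA p)); field; assumption. }
  assert (HC : forall p, hn p = 1 -> forall i, (i < n)%nat -> Rabs (px (u p) i) <= 1 /\ Rabs (py (u p) i) <= 1).
  { intros p _ i Hi; apply coord_bound; [lra|assumption|].
    destruct (Req_dec (A p) 0) as [E|E]; [|rewrite Hu; auto; lra].
    unfold u; rewrite ip_dil, E, Rinv_0; lra. }
  assert (H1 := fin_cells_comap u _ _ _ HC (fin_cells_close 1 e He)).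
  refine (fin_cells_weaken _ _ _ _ (fin_cells_and _ _ _ H1 (fin_cells_and _ _ _
    (fin_cells_iff _ (fun p => 0 <= pz p)) (fin_cells_iff _ (fun p => A p < alpha / 2))))).
  intros p q Hp Hq (Hc & Hz & Hs) eps Heps.
  assert (Ep := hnorm_eq n alpha alpha_gt0 p); fold hn in Ep; rewrite Hp, <- (proj2 (HA p)) in Ep.
  assert (Eq := hnorm_eq n alpha alpha_gt0 q); fold hn in Eq; rewrite Hq, <- (proj2 (HA q)) in Eq.
  apply dalpha_le; [assumption|lra|].
  assert (Ed : forall w, ip n p (dil eps w) = eps * ip n p w /\ om n p (dil eps w) = eps * om n p w).
  { intros w. rewrite <- (dil_1 p) at 1 3. rewrite ip_dil, om_dil; split; ring. }
  rewrite (proj1 (Ed q)), (proj2 (Ed q)), ip_dil, <- (proj2 (HA p)), <- (proj2 (HA q)).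
  change (pz (dil eps q)) with (eps ^ 2 * pz q).
  assert (D : A p * A q * (1 - eta) <= ip n p q /\ Rabs (om n p q) <= A p * A q * eta).
  { assert (Hi : ip n p q = A p * A q * ip n (u p) (u q) /\ om n p q = A p * A q * om n (u p) (u q)
               \/ A p = 0 \/ A q = 0).
    { destruct (Req_dec (A p) 0); [tauto|]. destruct (Req_dec (A q) 0); [tauto|]. left.
      unfold u; rewrite ip_dil, om_dil; split; field; auto. }
    assert (Z : forall w, A w = 0 -> ip n w w = 0) by (intros w E; rewrite <- (proj2 (HA w)), E; ring).
    destruct (Req_dec (A p) 0) as [E0|N0]; [|destruct (Req_dec (A q) 0) as [E0|N0']].
    - destruct (ip_self_eq0 n p q (Z p E0)) as [-> ->]. rewrite E0, Rabs_R0; lra.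
    - rewrite ip_comm, om_anticomm. destruct (ip_self_eq0 n q p (Z q E0)) as [-> ->].
      rewrite E0, Ropp_0, Rabs_R0; lra.
    - destruct Hi as [[-> ->]|]; [|tauto].
      destruct (close_estimates (u p) (u q) 1 e ltac:(lra) Hc (HC p Hp)) as (I1 & I2 & _).
      rewrite Hu in I1 by assumption.
      assert (0 <= A p * A q) by (apply Rmult_le_pos; apply HA).
      assert (2 * INR n * (1 * e) <= eta) by lra.
      pose proof (Rle_abs (- (ip n (u p) (u q) - 1))) as I3; rewrite Rabs_Ropp in I3.
      split; [apply Rmult_le_compat_l; lra|].
      rewrite Rabs_mult, Rabs_right by lra. apply Rmult_le_compat_l; lra. }
  destruct D as [D1 D2].
  pose proof (sphere_estimate alpha (A p) (A q) (ip n p q) (om n p q) (pz p) (pz q) eta eps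
    alpha_gt0 (proj1 (HA p)) (proj1 (HA q)) ltac:(lra) ltac:(lra) ltac:(lra) ltac:(lra)
    D1 D2 Hz Hs Heps) as G.
  nra.
Qed.

End Cells.

(** * Packing, Besicovitch families and the greedy choice *)

Section Covering.
Variables (n : nat) (alpha : R).
Hypothesis alpha_gt0 : 0 < alpha.

Let d := dalpha n alpha.

Hypothesis d_distance : is_distance n d.

(** Translating by [q^-1] and dilating by [1 / rho] reduces to an [s]-separated set in the unit
    ball, which meets each cell of [ball_cells] at most once. *)
Lemma packing s : 0 < s ->
  exists N, forall (X : Type) (f : X -> pt) (l : list X) q rho, NoDup l -> 0 < rho ->
    (forall x, In x l -> d q (f x) <= rho) ->
    (forall x y, In x l -> In y l -> x <> y -> s * rho < d (f x) (f y)) ->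
    (length l <= N)%nat.
Proof.
  intros Hs; destruct (separated_length _ _ (ball_cells n alpha alpha_gt0 s Hs)) as [N HN].
  exists N; intros X f l q rho Hl Hrho Hq Hsep.
  assert (Hi : 0 < / rho) by now apply Rinv_0_lt_compat.
  apply (HN X (fun x => dil (/ rho) (hmul n (hinv q) (f x))) l Hl).
  - intros x Hx; rewrite hnorm_dil, <- dalphaE by assumption.
    apply (Rmult_le_reg_l rho); [assumption|]. rewrite <- Rmult_assoc, Rinv_r by lra.
    specialize (Hq x Hx); unfold d in Hq; lra.
  - intros x y Hx Hy Hxy H; rewrite dalpha_dil, dalpha_left in H by assumption.
    apply (Rmult_le_compat_l rho) in H; [|lra]. rewrite <- Rmult_assoc, Rinv_r in H by lra.
    specialize (Hsep x y Hx Hy Hxy); unfold d in Hsep; lra.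
Qed.

(* The normalised points [g x = dil (/ rho) (q^-1 f x)], [rho = d q (f x)], lie on the unit sphere.
   Within a cell of [sphere_cells] the distances to [q] are comparable, hence packing applies. *)
Lemma besicovitch_family_bound :
  exists N, forall (X : Type) (f : X -> pt) (l : list X) q, NoDup l -> inH n q ->
    (forall x, In x l -> inH n (f x)) ->
    (forall x y, In x l -> In y l -> x <> y -> d q (f x) < d (f x) (f y)) ->
    (length l <= N)%nat.
Proof.
  destruct d_distance as (Dge & Deq & Dsym & Dtri).
  destruct (packing (/ 12)) as [K HK]; [lra|].
  destruct (fin_cells_length _ _ K (sphere_cells n alpha alpha_gt0)) as [N HN].
  exists (N + 1)%nat; intros X f l q Hl Hq Hf Hsep.
  (* If [q] is itself a center, any other center [x] would satisfy [d q x < d x q], so the family is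
     a singleton. *)
  destruct (classic (exists y, In y l /\ d q (f y) = 0)) as [(y & Hy & Ey)|Hpos].
  { enough (length l <= length (y :: nil))%nat by (simpl in *; lia).
    apply NoDup_incl_length; [assumption|]. intros x Hx; simpl.
    destruct (classic (y = x)) as [|Hxy]; [now left|exfalso].
    pose proof (Hsep x y Hx Hy ltac:(congruence)).
    pose proof (Dtri (f x) q (f y) (Hf x Hx) Hq (Hf y Hy)).
    rewrite (Dsym (f x) q) in *; auto. lra. }
  assert (Rpos : forall x, In x l -> 0 < d q (f x)).
  { intros x Hx; destruct (Dge q (f x) Hq (Hf x Hx)) as [|E]; [assumption|].
    exfalso; apply Hpos; eauto. }
  enough (length l <= N)%nat by lia.
  apply (HN X (fun x => dil (/ d q (f x)) (hmul n (hinv q) (f x))) l Hl).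
  - intros x Hx; specialize (Rpos x Hx).
    rewrite hnorm_dil, <- dalphaE by (auto using Rinv_0_lt_compat).
    fold d; apply Rinv_l; lra.
  - intros l' Hl' I HQ. destruct l' as [|a l0] eqn:El; [simpl; lia|rewrite <- El in *].
    destruct (max_element (fun x => d q (f x)) l') as (x0 & Hx0 & Hmax); [congruence|].
    assert (R0 := Rpos x0 (I x0 Hx0)).
    apply (HK X f l' q (d q (f x0))); auto.
    intros x y Hx Hy Hxy. pose proof (Hsep x y (I x Hx) (I y Hy) Hxy).
    (* Were [x] closer to [q] than [1/12] of the maximal distance, the cell property with [eps] the
       ratio of the two distances, dilated back, would give [d x0 x <= d q x0], contradicting
       separation. *)
    enough (/ 12 * d q (f x0) <= d q (f x)) by lra.
    apply Rnot_lt_le; intros Hlt. assert (R1 := Rpos x (I x Hx)).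
    assert (Hne : x0 <> x) by (intros ->; lra).
    specialize (HQ x0 x Hx0 Hx (d q (f x) / d q (f x0))).
    rewrite dil_dil in HQ.
    replace (d q (f x) / d q (f x0) * / d q (f x)) with (/ d q (f x0)) in HQ by (field; lra).
    assert (Hi : 0 < / d q (f x0)) by now apply Rinv_0_lt_compat.
    rewrite dalpha_dil, dalpha_left in HQ by assumption.
    assert (H1 : / d q (f x0) * d (f x0) (f x) <= 1).
    { apply HQ; split; [now apply Rdiv_lt_0_compat|].
      apply (Rmult_le_reg_r (d q (f x0))); [assumption|].
      unfold Rdiv; rewrite Rmult_assoc, Rinv_l by lra. lra. }
    apply (Rmult_le_compat_l (d q (f x0))) in H1; [|lra].
    rewrite <- Rmult_assoc, Rinv_r in H1 by lra.
    pose proof (Hsep x0 x (I x0 Hx0) (I x Hx) Hne). lra.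
Qed.

(** Take a longest [sigma]-separated list, which exists since [packing] bounds the lengths. All
    radii exceed [sigma], so an uncovered center is [sigma]-far from the list and its ball could be
    added. *)
Lemma greedy_generation (U : pt -> Prop) (Bf : ball -> Prop) p0 R0 sigma :
  inH n p0 -> 0 < R0 -> (forall a, U a -> inH n a /\ d p0 a <= R0) -> 0 < sigma ->
  exists l : list ball,
    (forall b, In b l -> Bf b /\ U (fst b) /\ sigma < snd b <= 2 * sigma) /\
    (forall b b', In b l -> In b' l -> b <> b' -> sigma < d (fst b) (fst b')) /\
    (forall a r, U a -> Bf (a, r) -> sigma < r <= 2 * sigma ->
       exists b, In b l /\ d a (fst b) <= snd b).
Proof.
  destruct d_distance as (Dge & Deq & Dsym & Dtri).
  intros Hp0 HR0 HU Hsig.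
  destruct (packing (sigma / R0)) as [M HM]; [now apply Rdiv_lt_0_compat|].
  set (P := fun l : list ball => NoDup l /\
    (forall b, In b l -> Bf b /\ U (fst b) /\ sigma < snd b <= 2 * sigma) /\
    (forall b b', In b l -> In b' l -> b <> b' -> sigma < d (fst b) (fst b'))).
  destruct (longest_list P M nil) as (l & (Hl & HB & Hs) & Hmax).
  { split; [constructor|split; simpl; tauto]. }
  { intros l (Hl & HB & Hs). apply (HM ball fst l p0 R0); auto.
    - intros b Hb; now apply HU, HB.
    - replace (sigma / R0 * R0) with sigma by (field; lra). assumption. }
  exists l; split; [assumption|split; [assumption|]].
  intros a r Ha Hr Hsr. apply NNPP; intros Hn.
  assert (Hfar : forall b, In b l -> sigma < d a (fst b)).
  { intros b Hb. apply Rnot_le_lt; intros Hle. apply Hn; exists b; split; [assumption|].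
    destruct (HB b Hb) as (_ & _ & ?); lra. }
  assert (Haa : d a a = 0) by (apply Deq; [apply HU| apply HU|]; auto).
  specialize (Hmax ((a, r) :: l)); simpl in Hmax.
  enough (P ((a, r) :: l)) by (specialize (Hmax H); lia).
  split; [|split].
  - constructor; [|assumption]. intros Hin; specialize (Hfar _ Hin); simpl in Hfar; lra.
  - intros b [<-|Hb]; auto.
  - intros b b' [<-|Hb] [<-|Hb'] Hne; simpl; auto.
    + tauto.
    + rewrite Dsym; auto; apply HU; auto. now apply HB.
Qed.

End Covering.

(** * From generations of balls to the covering property *)

Lemma dyadic_scale D r : 0 < r <= D -> exists k, D * (/ 2) ^ S k < r <= 2 * (D * (/ 2) ^ S k).
Proof.
  intros Hr. destruct (pow_lt_1_zero (/ 2) ltac:(rewrite Rabs_right; lra) (r / D)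
    ltac:(apply Rdiv_lt_0_compat; lra)) as [N HN].
  assert (H : D * (/ 2) ^ N < r).
  { specialize (HN N (le_n N)). rewrite Rabs_right in HN by (left; apply pow_lt; lra).
    apply (Rmult_lt_compat_l D) in HN; [|lra].
    replace (D * (r / D)) with r in HN by (field; lra). assumption. }
  clear HN; induction N as [|N IH]; [simpl in H; lra|].
  destruct (Rlt_le_dec (D * (/ 2) ^ N) r); [auto|].
  exists N; split; [assumption|simpl; lra].
Qed.

Theorem theorem1p5 (n : nat) (alpha : R) :
  (1 <= n)%nat -> 0 < alpha -> is_distance n (dalpha n alpha) ->
  BCP n (dalpha n alpha).
Proof.
  intros _ alpha_gt0 Hd.
  destruct (besicovitch_family_bound n alpha alpha_gt0 Hd) as [N HN].
  destruct (packing n alpha alpha_gt0 (/ 2)) as [K HK]; [lra|].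
  assert (Greedy := greedy_generation n alpha alpha_gt0 Hd).
  destruct Hd as (Dge & Deq & Dsym & Dtri).
  set (d := dalpha n alpha) in *.
  (* At most [N] generations meet a point, each in at most [K] balls; the extra 1 keeps the constant
     positive and covers the case of a single huge ball. *)
  exists (N * K + 1)%nat; split; [lia|].
  intros A Bf HA (p0 & R & Hp0 & HR) HBf HAB.
  set (R0 := Rmax R 1).
  assert (HR0 : R <= R0 /\ 1 <= R0) by (split; [apply Rmax_l|apply Rmax_r]).
  (* Points of [A] are at mutual distance at most [2 R0], so one ball of larger radius covers
     [A]. *)
  destruct (classic (exists a r, A a /\ Bf (a, r) /\ 2 * R0 < r)) as [(a & r & Ha & Hb & Hr)|Hsmall].
  { exists (eq (a, r)); split; [|split].
    - now intros b <-.
    - intros a' Ha'; exists (a, r); repeat split; auto; try apply HA; auto; simpl.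
      pose proof (Dtri a' p0 a (HA _ Ha') Hp0 (HA _ Ha)).
      pose proof (HR a Ha); pose proof (HR a' Ha'). rewrite (Dsym p0 a) in *; auto. lra.
    - intros q _ l Hl Hin. enough (length l <= length ((a, r) :: nil))%nat by (simpl in *; lia).
      apply NoDup_incl_length; [assumption|]. intros b Hbl; left; now apply Hin. }
  set (sigma := fun k => 2 * R0 * (/ 2) ^ S k).
  assert (Hsigma : forall k, 0 < sigma k)
    by (intros k; apply Rmult_lt_0_compat; [lra|apply pow_lt; lra]).
  assert (Hhalf : forall j k, (j < k)%nat -> 2 * sigma k <= sigma j).
  { assert (HS : forall k, 2 * sigma (S k) = sigma k) by (intros; unfold sigma; simpl; field).
    intros j k Hjk; induction Hjk as [|k Hjk IH]; [rewrite HS; lra|].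
    pose proof (HS k); pose proof (Hsigma k); lra. }
  set (covers := fun (l : list ball) a => exists b, In b l /\ d a (fst b) <= snd b).
  set (good := fun (U : pt -> Prop) k (l : list ball) =>
    (forall b, In b l -> Bf b /\ U (fst b) /\ sigma k < snd b <= 2 * sigma k) /\
    (forall b b', In b l -> In b' l -> b <> b' -> sigma k < d (fst b) (fst b')) /\
    (forall a r, U a -> Bf (a, r) -> sigma k < r <= 2 * sigma k -> covers l a)).
  (* The choice is made for all [U] at once, because the recursion defining [stage] runs before its
     values are known to lie in [A]. *)
  assert (Hpick : exists pick : (pt -> Prop) -> nat -> list ball,
    forall U k, (forall a, U a -> A a) -> good U k (pick U k)).
  { exists (fun U k => epsilon (inhabits nil) (good U k)); intros U k HU.
    apply epsilon_spec, (Greedy U Bf p0 R0); auto; try lra.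
    intros a Ha; split; [auto|]. rewrite Dsym; auto. pose proof (HR a (HU a Ha)); lra. }
  destruct Hpick as [pick Hpick].
  (* [stage k] is the part of [A] left uncovered by the generations before [k]. *)
  set (stage := fix stage k := match k with
    | O => A
    | S k => fun a => stage k a /\ ~ covers (pick (stage k) k) a
    end).
  set (gens := fun k => pick (stage k) k).
  assert (HsA : forall k a, stage k a -> A a).
  { induction k; simpl; [auto|]. intros a [Ha _]; auto. }
  assert (Hgood : forall k, good (stage k) k (gens k)) by (intros; apply Hpick, HsA).
  assert (Huncov : forall j k a, (j < k)%nat -> stage k a -> ~ covers (gens j) a).
  { intros j k a Hjk; induction Hjk as [|k Hjk IH]; intros [Hs Hc]; auto. }
  assert (Hcov : forall k a, A a -> stage k a \/ exists j, covers (gens j) a).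
  { induction k as [|k IH]; intros a Ha; [now left|].
    destruct (IH a Ha) as [Hs|]; [|now right].
    destruct (classic (covers (gens k) a)); [right; eauto|left; split; assumption]. }
  set (F := fun b => exists k, In b (gens k)).
  assert (HF : forall b, F b -> Bf b) by (intros b [k Hb]; now apply (Hgood k)).
  exists F; split; [assumption|split].
  { intros a Ha. enough (exists j, covers (gens j) a) as (j & b & Hb & Hab)
      by (exists b; repeat split; [exists j; assumption|now apply HA|now apply HA|assumption]).
    destruct (HAB a Ha) as [r Hr]. destruct (HBf _ Hr) as [_ Hr0]; simpl in Hr0.
    destruct (dyadic_scale (2 * R0) r) as [k Hk].
    { split; [assumption|]. apply Rnot_lt_le; intros Hlt; apply Hsmall; eauto. }
    destruct (Hcov k a Ha) as [Hs|]; [|assumption].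
    exists k; apply (Hgood k) with (r := r); auto. }
  intros q Hq l Hl Hin.
  set (gen := fun b => epsilon (inhabits O) (fun k => In b (gens k))).
  assert (Hgen : forall b, In b l -> In b (gens (gen b))).
  { intros b Hb; apply (epsilon_spec (inhabits O) (fun k => In b (gens k))), Hin, Hb. }
  assert (Hc : forall b, In b l -> inH n (fst b)) by (intros b Hb; now apply HBf, HF, Hin).
  assert (Hqb : forall b, In b l -> d q (fst b) <= snd b) by (intros b Hb; now apply Hin).
  assert (Hsize : forall b, In b l -> sigma (gen b) < snd b <= 2 * sigma (gen b)).
  { intros b Hb; now apply (Hgood (gen b)), Hgen. }
  destruct (distinct_values gen l Hl) as (l' & Hl' & I & Hdist & Hval).
  enough (length l <= length (map gen l') * K /\ length l' <= N)%nat by (rewrite length_map in *; nia).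
  split.
  - apply (pigeonhole gen); [assumption|assumption|].
    (* Centers of generation [k] are [sigma k]-separated and within [2 sigma k] of [q], whence the
       ratio [1/2]. *)
    intros k m Hm Im Em. apply (HK ball fst m q (2 * sigma k)); auto.
    + pose proof (Hsigma k); lra.
    + intros b Hb. specialize (Hsize b (Im b Hb)); specialize (Hqb b (Im b Hb)).
      rewrite (Em b Hb) in *. fold d; lra.
    + intros b b' Hb Hb' Hne. replace (/ 2 * (2 * sigma k)) with (sigma k) by field.
      destruct (Hgood k) as (_ & Sep & _).
      apply Sep; auto; [rewrite <- (Em b Hb)|rewrite <- (Em b' Hb')]; auto.
  (* The later center was left uncovered by the earlier ball, whose radius is also the larger, so
     the distance of the centers exceeds both radii. *)
  - assert (Hfar : forall b b', In b l -> In b' l -> (gen b < gen b')%nat ->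
      snd b < d (fst b) (fst b') /\ snd b' < d (fst b) (fst b')).
    { intros b b' Hb Hb' Hlt.
      assert (Hs : stage (gen b') (fst b')) by (now apply (Hgood (gen b')), Hgen).
      assert (H1 : snd b < d (fst b) (fst b')).
      { apply Rnot_le_lt; intros Hle. apply (Huncov _ _ _ Hlt Hs).
        exists b; split; [auto|]. rewrite Dsym; auto. }
      split; [assumption|]. apply Rle_lt_trans with (snd b); [|assumption].
      pose proof (Hsize b Hb); pose proof (Hsize b' Hb').
      enough (2 * sigma (gen b') <= sigma (gen b)) by lra.
      now apply Hhalf. }
    apply (HN ball fst l' q); auto.
    intros b b' Hb Hb' Hne. pose proof (Hqb b (I b Hb)).
    destruct (Nat.lt_gt_cases (gen b) (gen b')) as [Hlt _].
    destruct (Hlt (Hdist b b' Hb Hb' Hne)) as [H1|H1]; apply Hfar in H1; auto; fold d in H1; fold d.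
    + lra.
    + rewrite (Dsym (fst b)); auto; lra.
Qed.
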